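(* Let $k$ be a field with $u(k)\leq 2$ which is not quadratically closed, with $\mathrm{char}(k)\neq 2$ and $|k|>5$. Let $\mathscr{C}$ be a conjugacy class in $\mathrm{SL}_2(k)$. Then, for $\overline{\epsilon}\in k^{\times}/k^{\times 2}$, $\mathscr{C}\subseteq U_{-1,\overline{\epsilon}}^2$ if and only if one of the following holds: (1) $\mathscr{C}$ is a semisimple conjugacy class with $2-\mathrm{tr}(\mathscr{C})\in k^{\times 2}$; (2) $\mathscr{C}$ is a unipotent conjugacy class; (3) $\mathscr{C}=U_{-1,\overline{-\epsilon}}$; (4) $\mathscr{C}=\{I\}$ and $-1\in k^{\times 2}$.
   Context: A field $k$ has $u(k)\leq 2$ if every quadratic form in $3$ variables over $k$ is isotropic. A field is quadratically closed if it admits no quadratic extension. $k^{\times 2}$ is the set of squares in $k^\times$, and $\bar\epsilon$ is the image of $\epsilon\in k^\times$ in $k^\times/k^{\times2}$. $U_{\overline{\epsilon}}$ denotes the $\mathrm{SL}_2(k)$-conjugacy class of $\begin{pmatrix}1&\epsilon\\0&1\end{pmatrix}$ and $U_{-1,\overline{\epsilon}}$ that of $\begin{pmatrix}-1&\epsilon\\0&-1\end{pmatrix}$; both depend only on $\overline{\epsilon}$. The unipotent conjugacy classes are exactly the $U_{\overline{\epsilon}}$ (so $\{I\}$ is not counted as unipotent). Semisimple classes are non-central. $\mathrm{tr}(\mathscr{C})$ is the common trace of elements of $\mathscr{C}$, and $A^2=\{xy:x,y\in A\}$. *)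

(* Defs.v *)
From mathcomp Require Import all_boot all_order all_algebra all_field.
From mathcomp Require Import boolp classical_sets.

Set Implicit Arguments.
Unset Strict Implicit.
Unset Printing Implicit Defensive.

Import GRing.Theory.
Local Open Scope ring_scope.
Local Open Scope classical_set_scope.

Section Fields.
Variable k : fieldType.

(* The coefficients a i j with i > j are ignored, so this covers each quadratic
   form in n variables, in any characteristic. *)
Definition quad_form n (a : 'M[k]_n) (x : 'rV[k]_n) : k :=
  \sum_(i < n) \sum_(j < n | (i <= j)%N) a i j * x 0 i * x 0 j.

Definition isotropic n (a : 'M[k]_n) : Prop :=
  exists2 x : 'rV[k]_n, x != 0 & quad_form a x = 0.

Definition u_le2 : Prop := forall a : 'M[k]_3, isotropic a.

Definition quadratically_closed : Prop :=
  ~ exists L : fieldExtType k, \dim {:L} = 2%N.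

Definition more_than_elements (n : nat) : Prop :=
  exists s : seq k, uniq s /\ (n < size s)%N.

Definition unit_squares : set k := [set x | exists2 y, y != 0 & x = y ^+ 2].

Definition SL2 : set 'M[k]_2 := [set A | \det A = 1].

Definition SL2_class (A : 'M[k]_2) : set 'M[k]_2 :=
  [set g *m A *m invmx g | g in SL2].

Definition SL2_conjugacy_class (C : set 'M[k]_2) : Prop :=
  exists2 A, SL2 A & C = SL2_class A.

Definition mx2 (a b c d : k) : 'M[k]_2 :=
  \matrix_(i, j) if i == 0 then (if j == 0 then a else b)
                 else (if j == 0 then c else d).

(* U_(eps) and U_(-1, eps), indexed by a representative eps of a class of
   k^* / k^*2; see U_class_squares and Um1_class_squares. *)
Definition U_class (e : k) : set 'M[k]_2 := SL2_class (mx2 1 e 0 1).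
Definition Um1_class (e : k) : set 'M[k]_2 := SL2_class (mx2 (-1) e 0 (-1)).

Definition SL2_central (A : 'M[k]_2) : Prop :=
  forall g, SL2 g -> g *m A = A *m g.

(* Diagonalizable over an algebraic closure; as the eigenvectors then have
   coordinates in a finite extension of k, no closure has to be chosen. *)
Definition semisimple (A : 'M[k]_2) : Prop :=
  exists L : fieldExtType k, diagonalizable (map_mx (in_alg L) A).

Definition semisimple_class (C : set 'M[k]_2) : Prop :=
  exists A, [/\ SL2 A, C = SL2_class A, ~ SL2_central A & semisimple A].

Definition unipotent_class (C : set 'M[k]_2) : Prop :=
  exists2 e : k, e != 0 & C = U_class e.

(* The trace of an arbitrarily chosen element of C; see class_traceE. *)
Definition class_trace (C : set 'M[k]_2) : k := \tr (xget 0 C).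

Definition set_square (X : set 'M[k]_2) : set 'M[k]_2 :=
  [set x *m y | x in X & y in X].

Lemma SL2_unit (g : 'M[k]_2) : SL2 g -> g \in unitmx.
Proof. by rewrite unitmxE => ->; rewrite unitr1. Qed.

Lemma SL2_mul (g h : 'M[k]_2) : SL2 g -> SL2 h -> SL2 (g *m h).
Proof. by rewrite /SL2 /= det_mulmx => -> ->; rewrite mulr1. Qed.

Lemma SL2_inv (g : 'M[k]_2) : SL2 g -> SL2 (invmx g).
Proof. by rewrite /SL2 /= det_inv => ->; rewrite invr1. Qed.

Lemma SL2_class_refl (A : 'M[k]_2) : SL2_class A A.
Proof.
by exists 1%:M; rewrite /SL2 /= ?det1 // invmx1 mul1mx mulmx1.
Qed.

Lemma mxtrace_SL2_class (A B : 'M[k]_2) : SL2_class A B -> \tr B = \tr A.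
Proof.
by case=> g /SL2_unit gU <-; rewrite mxtrace_mulC mulmxA mulVmx // mul1mx.
Qed.

Lemma class_traceE (C : set 'M[k]_2) (A : 'M[k]_2) :
  SL2_conjugacy_class C -> C A -> class_trace C = \tr A.
Proof.
case=> B _ -> BA; rewrite /class_trace (mxtrace_SL2_class BA).
by apply: mxtrace_SL2_class; apply: (xgetPex 0); exists A.
Qed.

Lemma SL2_class_conj (g A : 'M[k]_2) :
  SL2 g -> SL2_class (g *m A *m invmx g) = SL2_class A.
Proof.
move=> gS; have gU := SL2_unit gS.
rewrite eqEsubset; split=> _ [h hS <-].
- exists (h *m g); first exact: SL2_mul.
  have hgU : h *m g \in unitmx by apply/SL2_unit/SL2_mul.
  by rewrite -[RHS](mulmxK hgU) !mulmxA mulmxKV ?SL2_unit // mulmxKV.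
- have hgS := SL2_mul hS (SL2_inv gS).
  exists (h *m invmx g) => //; rewrite -[RHS](mulmxK (SL2_unit hgS)).
  congr (_ *m _); rewrite !mulmxA !mulmxKV //.
  by rewrite SL2_unit.
Qed.

Lemma SL2_class_upper_squares (s e c : k) : c != 0 ->
  SL2_class (mx2 s (e * c ^+ 2) 0 s) = SL2_class (mx2 s e 0 s).
Proof.
move=> c0; have dS : SL2 (mx2 c 0 0 c^-1).
  rewrite /SL2 /= det_trig.
    by rewrite !big_ord_recl big_ord0 !mxE /= mulr1 divff.
  by apply/is_trig_mxP => -[[|[|//]] ?] [[|[|//]] ?] //=; rewrite mxE.
rewrite -[RHS](SL2_class_conj _ dS); congr SL2_class.
rewrite -[LHS](mulmxK (SL2_unit dS)); congr (_ *m _).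
apply/matrixP=> i j; rewrite !mxE !big_ord_recl !big_ord0 !mxE.
case: i => [[|[|//]]] ?; case: j => [[|[|//]]] ? /=;
  rewrite ?(mulr0, mul0r, addr0, add0r) // 1?[RHS]mulrC //.
by rewrite expr2 mulrA mulfK.
Qed.

Lemma U_class_squares (e c : k) : c != 0 -> U_class (e * c ^+ 2) = U_class e.
Proof. exact: SL2_class_upper_squares. Qed.

Lemma Um1_class_squares (e c : k) :
  c != 0 -> Um1_class (e * c ^+ 2) = Um1_class e.
Proof. exact: SL2_class_upper_squares. Qed.

End Fields.

(* Main.v *)
(* The elements of U_(-1,eps) are the matrices -1 + eps N_v, v = (a, c) != 0, with
   N_v the nilpotent matrix of image k v that is quadratic in v.  Up to conjugacy
   the first factor of a product is given by v = (1, 0), so the product is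
   [Um1_prod eps a c], of trace 2 - (eps c)^2 and lower left entry eps c^2.
   The class of a non-scalar A of SL_2(k) is determined by its trace and by one
   nonzero value of the binary form det(v, A v), whose discriminant is tr(A)^2 - 4.
   As u(k) <= 2, nondegenerate binary forms are universal; hence for
   tr(A) <> 2, -2 the trace alone determines the class, while 1 + a^2 with a != 0
   meets every square class, so all unipotent classes occur for c = 0. *)

Require Import Defs.
From mathcomp Require Import all_boot all_order all_algebra all_field.
From mathcomp Require Import boolp classical_sets.
From mathcomp Require Import ring.

Set Implicit Arguments.
Unset Strict Implicit.
Unset Printing Implicit Defensive.

Import GRing.Theory.
Local Open Scope ring_scope.
Local Open Scope classical_set_scope.

(** * Conjugacy in SL_2 in coordinates *)

Section TwoByTwo.
Variable k : fieldType.
Implicit Types A B : 'M[k]_2.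

Lemma mx2_eta A : A = mx2 (A 0 0) (A 0 1) (A 1 0) (A 1 1).
Proof.
apply/matrixP=> i j; rewrite mxE.
by case: i => [[|[|//]] ?]; case: j => [[|[|//]] ?] /=; congr (A _ _); apply/val_inj.
Qed.

Lemma mx2_inj a b c d a' b' c' d' :
  mx2 a b c d = mx2 a' b' c' d' :> 'M[k]_2 -> [/\ a = a', b = b', c = c' & d = d'].
Proof.
move=> /matrixP E; move: (E 0 0) (E 0 1) (E 1 0) (E 1 1).
by rewrite !mxE.
Qed.

Lemma mul_mx2 a b c d a' b' c' d' :
  mx2 a b c d *m mx2 a' b' c' d' =
  mx2 (a * a' + b * c') (a * b' + b * d') (c * a' + d * c') (c * b' + d * d')
  :> 'M[k]_2.
Proof.
apply/matrixP=> i j; rewrite !mxE !big_ord_recl !big_ord0 !mxE /= addr0.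
by case: i => [[|[|//]] ?]; case: j => [[|[|//]] ?].
Qed.

Lemma det_mx2 a b c d : \det (mx2 a b c d) = a * d - b * c :> k.
Proof.
rewrite (expand_det_row _ 0) !big_ord_recl big_ord0 /cofactor !det_mx11 !mxE /=.
ring.
Qed.

Lemma mxtrace_mx2 a b c d : \tr (mx2 a b c d) = a + d :> k.
Proof. by rewrite /mxtrace !big_ord_recl big_ord0 !mxE /= addr0. Qed.

Lemma scalar_mx2 a : a%:M = mx2 a 0 0 a :> 'M[k]_2.
Proof. by rewrite [LHS]mx2_eta !mxE. Qed.

Lemma SL2_mx2 a b c d : SL2 (mx2 a b c d : 'M[k]_2) <-> a * d - b * c = 1.
Proof. by rewrite /SL2 /= det_mx2. Qed.

Lemma SL2_classP A B : SL2_class A B <-> exists2 g, SL2 g & g *m A = B *m g.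
Proof.
split=> -[g gS].
  by move=> <-; exists g; rewrite // mulmxKV ?SL2_unit.
by move=> gA; exists g; rewrite // gA mulmxK ?SL2_unit.
Qed.

Lemma SL2_class_eq A B : SL2_class A B -> SL2_class B = SL2_class A.
Proof. by case=> g gS <-; exact: SL2_class_conj. Qed.

Lemma SL2_class_scalar a : SL2_class a%:M = [set a%:M : 'M[k]_2].
Proof.
rewrite eqEsubset; split=> [_ [g gS <-]|_ -> /=]; last exact: SL2_class_refl.
by rewrite /= scalar_mxC mulmxK ?SL2_unit.
Qed.

(* The class of [B] is recorded by the binary form [v |-> det (v, B v)], whose
   values are exactly the possible lower left entries. *)
Lemma SL2_class_companion a b c d x y w : SL2 (mx2 a b c d : 'M[k]_2) ->
    w != 0 -> c * x ^+ 2 + (d - a) * x * y - b * y ^+ 2 = w ->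
  SL2_class (mx2 a b c d) = SL2_class (mx2 0 (- w^-1) w (a + d)).
Proof.
move=> /SL2_mx2 dA w0 Ew; apply/SL2_class_eq/SL2_classP.
(* The columns are v = (x, y) and A v / w, so the determinant is det(v, A v) / w = 1. The
   conjugation identity is then Cayley-Hamilton applied to v. *)
exists (mx2 x ((a * x + b * y) / w) y ((c * x + d * y) / w)).
  apply/SL2_mx2.
  have -> : x * ((c * x + d * y) / w) - (a * x + b * y) / w * y =
            (c * x ^+ 2 + (d - a) * x * y - b * y ^+ 2) / w by ring.
  by rewrite Ew divff.
have ad : a * d = 1 + b * c by rewrite -dA subrK.
by rewrite !mul_mx2; congr mx2; field: ad.
Qed.

(** Only the first column v = (a, c) of the conjugating matrix matters: the nilpotent part e E_12
    becomes e times the column v times the row (-c, a). *)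
Lemma SL2_class_upperP s e B : SL2_class (mx2 s e 0 s) B <->
  exists a c, (a != 0 \/ c != 0) /\
    B = mx2 (s - e * a * c) (e * a ^+ 2) (- (e * c ^+ 2)) (s + e * a * c).
Proof.
split=> [/SL2_classP[g gS]|[a [c [ac0 ->]]]].
  move: (gS); rewrite (mx2_eta g); move: (g 0 0) (g 0 1) (g 1 0) (g 1 1).
  move=> a b c d hS gM; exists a, c; split.
    case: (eqVneq a 0) => [a0|]; last by left.
    right; apply: contra_eq_neq (proj1 (SL2_mx2 _ _ _ _) hS) => ->.
    by rewrite a0 mul0r mulr0 subr0 eq_sym oner_eq0.
  apply: (can_inj (mulmxK (SL2_unit hS))); rewrite -gM.
  have /SL2_mx2 dg := hS; have ad : a * d = 1 + b * c by rewrite -dg subrK.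
  by rewrite !mul_mx2; congr mx2; ring: ad.
(* Complete the nonzero column (a, c) to a matrix of determinant 1. *)
apply/SL2_classP; case: (eqVneq a 0) => [a0|a0].
  have c0 : c != 0 by case: ac0; rewrite ?a0 ?eqxx.
  exists (mx2 0 (- c^-1) c 0); first by apply/SL2_mx2; field.
  by rewrite a0 !mul_mx2; congr mx2; field.
exists (mx2 a 0 c a^-1); first by apply/SL2_mx2; field.
by rewrite !mul_mx2; congr mx2; field.
Qed.

(** * Products of two elements of U_(-1,e) *)

Definition Um1_prod e a c : 'M[k]_2 :=
  mx2 (1 + e * a * c - (e * c) ^+ 2) (e ^+ 2 * a * c - e * (1 + a ^+ 2))
      (e * c ^+ 2) (1 - e * a * c).

Lemma Um1_prodE e a c : Um1_prod e a c =
  mx2 (-1) e 0 (-1) *m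
  mx2 (-1 - e * a * c) (e * a ^+ 2) (- (e * c ^+ 2)) (-1 + e * a * c).
Proof. by rewrite mul_mx2; congr mx2; ring. Qed.

Lemma SL2_Um1_prod e a c : SL2 (Um1_prod e a c).
Proof. by apply/SL2_mx2; ring. Qed.

Lemma mxtrace_Um1_prod e a c : \tr (Um1_prod e a c) = 2 - (e * c) ^+ 2.
Proof. by rewrite mxtrace_mx2; ring. Qed.

Lemma Um1_class_conj e g B :
  SL2 g -> Um1_class e B -> Um1_class e (g *m B *m invmx g).
Proof.
rewrite /Um1_class => gS /SL2_class_eq <-.
by rewrite -(SL2_class_conj B gS); exact: SL2_class_refl.
Qed.

(** The set of products is stable under conjugation, so a class lies in it as soon as one element
    does, and that element may be chosen with first factor [mx2 (-1) e 0 (-1)]. *)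
Lemma class_subset_Um1_square e A :
  SL2_class A `<=` set_square (Um1_class e) <->
  exists a c, (a != 0 \/ c != 0) /\ SL2_class A = SL2_class (Um1_prod e a c).
Proof.
split=> [sAU|[a [c [ac0 ->]]] _ [h hS <-]].
  have [x [g gS <-] [y Uy <-]] := sAU _ (SL2_class_refl A).
  have gU := SL2_unit gS.
  have := Um1_class_conj (SL2_inv gS) Uy; rewrite invmxK.
  move=> /SL2_class_upperP[a [c [ac0 Ey]]]; exists a, c; split=> //.
  rewrite Um1_prodE -Ey -[RHS](SL2_class_conj _ gS); congr SL2_class.
  by rewrite !mulmxA mulmxK.
have hU := SL2_unit hS.
rewrite Um1_prodE; set M := mx2 (-1) e 0 (-1); set y := mx2 _ _ _ _.
have Uy : Um1_class e y by apply/SL2_class_upperP; exists a, c.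
exists (h *m M *m invmx h); first by apply: Um1_class_conj => //; exact: SL2_class_refl.
exists (h *m y *m invmx h); first exact: Um1_class_conj.
by rewrite !mulmxA mulmxKV.
Qed.

(** * Universality of binary forms, and classes determined by their trace *)

(** Subtracting w z^2 gives a ternary form, which has a nontrivial zero. If z != 0, dividing by z
    represents w; if z = 0, the binary form is isotropic and nondegenerate, hence takes every
    value. *)
Lemma binary_form_universal (p q r w : k) : u_le2 k ->
  q ^+ 2 - 4 * p * r != 0 -> w != 0 ->
  exists x y, p * x ^+ 2 + q * x * y + r * y ^+ 2 = w.
Proof.
move=> hu disc0 w0.
(* Entries below the diagonal are ignored by [quad_form], so the last row contributes only - w
   z^2. *)
pose M : 'M[k]_3 := \matrix_(i, j)
  (if i == 0 then if j == 0 then p else if j == 1 then q else 0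
   else if i == 1 then if j == 1 then r else 0 else - w).
have [v] := hu M; rewrite /quad_form !big_ord_recl !big_ord0 /=.
do 2!rewrite !big_mkcond !big_ord_recl !big_ord0 !mxE /=.
set x := v 0 _; set y := v 0 _; set z := v 0 _ => v0 Q0.
have {}Q0 : p * x ^+ 2 + q * x * y + r * y ^+ 2 = w * z ^+ 2.
  by apply/eqP; rewrite -subr_eq0 -Q0; apply/eqP; ring.
have {v0} xyz0 : [|| x != 0, y != 0 | z != 0].
  apply: contra_neqT v0; rewrite !negb_or !negbK => /and3P[/eqP x0 /eqP y0 /eqP z0].
  apply/rowP => i; rewrite mxE.
  by case: i => [[|[|[|//]]] ?]; [rewrite -x0|rewrite -y0|rewrite -z0];
     congr (v _ _); apply/val_inj.
case: (eqVneq z 0) xyz0 Q0 => [->|z0 _ Q0]; last first.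
  exists (x / z), (y / z).
  have -> : p * (x / z) ^+ 2 + q * (x / z) * (y / z) + r * (y / z) ^+ 2 =
            (p * x ^+ 2 + q * x * y + r * y ^+ 2) / z ^+ 2 by field.
  by rewrite Q0; field.
rewrite orbF expr0n mulr0 => xy0 Q0.
(* [(x, y)] is isotropic, so the form is affine along the lines directed by it. *)
have affine s t : 2 * p * x * s + q * (x * t + y * s) + 2 * r * y * t != 0 ->
  exists x' y', p * x' ^+ 2 + q * x' * y' + r * y' ^+ 2 = w.
  set b := (X in X != 0) => b0; pose m := (w - (p * s ^+ 2 + q * s * t + r * t ^+ 2)) / b.
  exists (s + m * x), (t + m * y).
  have -> : p * (s + m * x) ^+ 2 + q * (s + m * x) * (t + m * y) + r * (t + m * y) ^+ 2 =
    (p * s ^+ 2 + q * s * t + r * t ^+ 2) + m * b +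
      m ^+ 2 * (p * x ^+ 2 + q * x * y + r * y ^+ 2) by rewrite /b; ring.
  by rewrite Q0 mulr0 addr0 /m; field.
(* The slopes along (1, 0) and (0, 1) are the partial derivatives of the form at (x, y). If both
   vanish, Cramer's rule shows that the discriminant kills x and y. *)
case: (eqVneq (2 * p * x + q * y) 0) => [b1|b1]; last first.
  by apply: (affine 1 0); apply: contra_neq b1 => <-; ring.
case: (eqVneq (q * x + 2 * r * y) 0) => [b2|b2]; last first.
  by apply: (affine 0 1); apply: contra_neq b2 => <-; ring.
have dx : (q ^+ 2 - 4 * p * r) * x = 0.
  have -> : (q ^+ 2 - 4 * p * r) * x =
    q * (q * x + 2 * r * y) - 2 * r * (2 * p * x + q * y) by ring.
  by rewrite b1 b2; ring.
have dy : (q ^+ 2 - 4 * p * r) * y = 0.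
  have -> : (q ^+ 2 - 4 * p * r) * y =
    q * (2 * p * x + q * y) - 2 * p * (q * x + 2 * r * y) by ring.
  by rewrite b1 b2; ring.
by move: dx dy xy0 => /eqP + /eqP; rewrite !mulf_eq0 (negPf disc0) /= => -> ->.
Qed.

(** The form det(v, A v) has discriminant tr(A)^2 - 4 != 0, so it takes the value 1, and A is
    conjugate to a companion matrix depending only on the trace. *)
Lemma SL2_class_trace A B : u_le2 k -> SL2 A -> SL2 B -> \tr A = \tr B ->
  \tr A ^+ 2 != 4 -> SL2_class A = SL2_class B.
Proof.
move=> hu; suff normal A' : SL2 A' -> \tr A' ^+ 2 != 4 ->
    SL2_class A' = SL2_class (mx2 0 (- 1^-1) 1 (\tr A')).
  by move=> AS BS tAB tA; rewrite (normal A) // (normal B) -?tAB.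
rewrite (mx2_eta A'); move: (A' 0 0) (A' 0 1) (A' 1 0) (A' 1 1) => a b c d.
rewrite mxtrace_mx2 => AS t4; have /SL2_mx2 dA := AS.
have [||x [y Exy]] := @binary_form_universal c (d - a) (- b) 1 hu.
- have -> : (d - a) ^+ 2 - 4 * c * - b = (a + d) ^+ 2 - 4 * (a * d - b * c) by ring.
  by rewrite dA mulr1 subr_eq0.
- exact: oner_neq0.
by apply: (SL2_class_companion (x := x) (y := y) AS (oner_neq0 k)); rewrite -[RHS]Exy; ring.
Qed.

(** * Semisimplicity and the trace *)

Lemma double_root (F : fieldType) (s a d : F) :
  s ^+ 2 = 1 -> a + d = 2 * s -> a * d = 1 -> a = s /\ d = s.
Proof.
move=> s1 tA dA; have Ed : d = 2 * s - a by rewrite -tA; ring.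
have Ea : a = s.
  apply/eqP; rewrite -subr_eq0 -sqrf_eq0; apply/eqP.
  have -> : (a - s) ^+ 2 = s ^+ 2 - a * (2 * s - a) by ring.
  by rewrite s1 -Ed dA subrr.
by rewrite Ed Ea; split; ring.
Qed.

(** The roots z and tr(A) - z of the characteristic polynomial are distinct, and by Cayley-Hamilton
    the minimal polynomial divides the product of the two linear factors. *)
Lemma diagonalizable_trace A z : SL2 A -> \tr A ^+ 2 != 4 ->
  z ^+ 2 - \tr A * z + 1 = 0 -> diagonalizable A.
Proof.
rewrite (mx2_eta A); move: (A 0 0) (A 0 1) (A 1 0) (A 1 1) => a b c d.
rewrite mxtrace_mx2 => /SL2_mx2 dA t4 Ez.
have z2 : z ^+ 2 = (a + d) * z - 1 by apply/eqP; rewrite -subr_eq0 -Ez; apply/eqP; ring.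
apply/diagonalizableP; exists [:: z; a + d - z].
  rewrite /= andbT inE; apply: contra_neq t4 => Et.
  have -> : (a + d) ^+ 2 = 4 * ((a + d) * z - z ^+ 2) + (a + d - z - z) ^+ 2 by ring.
  by rewrite -Et subrr z2; ring.
have Eprod : (mx2 a b c d - z%:M) *m (mx2 a b c d - (a + d - z)%:M) = 0.
  have sub (x : k) : mx2 a b c d - x%:M = mx2 (a - x) b c (d - x).
    by rewrite scalar_mx2 [LHS]mx2_eta !mxE /= !subr0.
  rewrite !sub mul_mx2 [RHS]mx2_eta !mxE.
  have z2' : z ^+ 2 = (a + d) * z - (a * d - b * c) by rewrite dA.
  by congr mx2; ring: z2'.
apply: mxminpoly_min.
rewrite !big_cons big_nil mulr1 rmorphM !rmorphB /= horner_mx_X !horner_mx_C.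
by rewrite -Eprod (raddfB (@scalar_mx _ _)) -!mulmxE.
Qed.

(** The diagonal form of A has both entries equal to s, so it is scalar and unchanged by
    conjugation. *)
Lemma diagonalizable_double_eigenvalue s A : s ^+ 2 = 1 -> SL2 A ->
  \tr A = 2 * s -> diagonalizable A -> A = s%:M.
Proof.
move=> s1 AS tA [P PU]; rewrite /similar_to conjumx // => /is_diag_mxP Ddiag.
suff E : P *m A *m invmx P = s%:M.
  have -> : A = invmx P *m (P *m A *m invmx P) *m P.
    by rewrite !mulmxA mulVmx // mul1mx mulmxKV.
  by rewrite E scalar_mxC mulmxKV.
have tD : \tr (P *m A *m invmx P) = 2 * s.
  by rewrite mxtrace_mulC mulmxA mulVmx // mul1mx.
have dD : \det (P *m A *m invmx P) = 1.
  rewrite !det_mulmx det_inv AS mulr1 divff //.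
  by rewrite -unitfE -unitmxE.
move: (P *m A *m invmx P) Ddiag tD dD => D Ddiag.
rewrite (mx2_eta D) (Ddiag 0 1) // (Ddiag 1 0) // mxtrace_mx2 det_mx2 mulr0 subr0 => tD dD.
by have [-> ->] := double_root s1 tD dD; rewrite scalar_mx2.
Qed.

End TwoByTwo.

Section Semisimple.
Variable k : fieldType.
Implicit Types A : 'M[k]_2.

(** In degree 1 to 3, a polynomial without roots is irreducible; so p has an irreducible factor, a
    root of which is adjoined. *)
Lemma root_fieldExt (p : {poly k}) : (1 < size p <= 4)%N ->
  exists (L : fieldExtType k) (z : L), root (map_poly (in_alg L) p) z.
Proof.
move=> sp.
have [q irr_q qp] : exists2 q, irreducible_poly q & q %| p.
  have [[a pa]|nroot] := EM (exists a, root p a).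
    exists ('X - a%:P); last by rewrite dvdp_XsubCl.
    exact: irredp_XsubC.
  exists p => //; apply: cubic_irreducible => // a.
  by apply/negP => pa; apply: nroot; exists a.
have [L _ [z qz _]] := irredp_FAdjoin irr_q.
by exists L, z; apply: root_dvdp qz; rewrite dvdp_map.
Qed.

Lemma semisimple_trace A : SL2 A -> \tr A ^+ 2 != 4 -> semisimple A.
Proof.
move=> AS t4; pose p : {poly k} := 'X^2 - \tr A *: 'X + 1.
have sp : size p = 3%N.
  rewrite /p -addrA size_polyDl size_polyXn //.
  rewrite (leq_ltn_trans (size_polyD _ _)) // gtn_max size_poly1 andbT.
  by rewrite size_polyN (leq_ltn_trans (size_scale_leq _ _)) // size_polyX.
have [|L [z]] := @root_fieldExt p; first by rewrite sp.
rewrite /root !(rmorphD, rmorphN) /= map_polyZ map_polyXn map_polyX rmorph1.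
rewrite !hornerE => /eqP pz; exists L; apply: (@diagonalizable_trace _ _ z).
- by rewrite /SL2 /= det_map_mx AS rmorph1.
- rewrite trace_map_mx; apply: contra_neq t4 => E.
  by apply: (fmorph_inj (in_alg L)); rewrite rmorphXn E rmorph_nat.
- by rewrite trace_map_mx.
Qed.

(** With s = -1 this excludes trace -2 for a non-central semisimple class. *)
Lemma semisimple_double_eigenvalue s A : s ^+ 2 = 1 -> SL2 A ->
  \tr A = 2 * s -> semisimple A -> A = s%:M.
Proof.
move=> s1 AS tA [L dA].
apply: (map_mx_inj (f := in_alg L)); rewrite map_scalar_mx.
apply: diagonalizable_double_eigenvalue dA.
- by rewrite -rmorphXn s1 rmorph1.
- by rewrite /SL2 /= det_map_mx AS rmorph1.
- by rewrite trace_map_mx tA rmorphM rmorph_nat.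
Qed.

End Semisimple.

(** * Which classes the products realize *)

Section ProductClasses.
Variable k : fieldType.

(** By universality w = x^2 + y^2. If x and y are nonzero, divide by x^2; otherwise w is a square,
    and points of the hyperbola b^2 - a^2 = 1 are used. *)
Lemma one_add_square_mod_squares (w : k) : u_le2 k -> (2 : k) != 0 ->
  more_than_elements k 5 -> w != 0 ->
  exists a b : k, [/\ a != 0, b != 0 & w * b ^+ 2 = 1 + a ^+ 2].
Proof.
move=> hu c2 [s [us ss]] w0.
have c4 : (4 : k) != 0.
  have -> : (4 : k) = 2 * 2 by ring.
  exact: mulf_neq0.
have square z : z != 0 -> w = z ^+ 2 ->
    exists a b : k, [/\ a != 0, b != 0 & w * b ^+ 2 = 1 + a ^+ 2].
  move=> z0 ->.
  (* [b^2 - a^2 = 1] with [b + a = t] and [b - a = 1/t]; then [a, b != 0] excludes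
     only the at most 5 roots of [t^5 - t]. *)
  have [t ts] : exists2 t : k, t != 0 & (t ^+ 2 - 1) * (t ^+ 2 + 1) != 0.
    have p0 : ('X^5 - 'X : {poly k}) != 0.
      by rewrite -size_poly_eq0 size_polyDl size_polyXn ?size_polyN ?size_polyX.
    have : ~~ all (root ('X^5 - 'X)) s.
      apply/negP => rs; have := max_poly_roots p0 rs us.
      by rewrite size_polyDl size_polyXn ?size_polyN ?size_polyX // ltnNge ss.
    case/allPn => t _; rewrite /root !hornerE => Ht; exists t.
      by apply: contra_neq Ht => ->; ring.
    by apply: contra_neq Ht => E; rewrite -[RHS](mulr0 t) -E; ring.
  rewrite mulf_eq0 negb_or => /andP[tm tp].
  exists ((t ^+ 2 - 1) / (2 * t)), ((t ^+ 2 + 1) / (2 * t * z)); split.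
  - by rewrite mulf_neq0 ?invr_eq0 ?mulf_neq0.
  - by rewrite mulf_neq0 ?invr_eq0 ?mulf_neq0.
  - by field; rewrite z0 ts c2.
have [|x [y Exy]] := @binary_form_universal k 1 0 1 w hu _ w0.
  have -> : 0 ^+ 2 - 4 * 1 * 1 = - (4 : k) by ring.
  by rewrite oppr_eq0.
have {}Exy : w = x ^+ 2 + y ^+ 2 by rewrite -Exy; ring.
case: (eqVneq x 0) => [x0|x0].
  rewrite x0 expr0n add0r in Exy; apply: (square y) => //.
  by apply: contra_neq w0; rewrite Exy => ->; rewrite expr0n.
case: (eqVneq y 0) => [y0|y0].
  by rewrite y0 expr0n addr0 in Exy; apply: (square x).
exists (y / x), x^-1; split; rewrite ?mulf_neq0 ?invr_eq0 //.
by rewrite Exy; field.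
Qed.

Lemma Um1_prod_upper (e a : k) : Um1_prod e a 0 = mx2 1 (- e * (1 + a ^+ 2)) 0 1.
Proof. by congr mx2; ring. Qed.

(** Both sides have trace -2, and their forms both take the value e c^2, at (1, 0) and at (0, c)
    respectively; hence they share a companion matrix. *)
Lemma Um1_prod_class_trm2 (e a c : k) : c != 0 -> e != 0 ->
  (e * c) ^+ 2 = 4 -> SL2_class (Um1_prod e a c) = Um1_class (- e).
Proof.
move=> c0 e0 E4; have w0 : e * c ^+ 2 != 0 by rewrite mulf_neq0 ?expf_neq0.
have PS := SL2_Um1_prod e a c.
rewrite [LHS](SL2_class_companion (x := 1) (y := 0) PS w0); last by ring.
rewrite /Um1_class [RHS](SL2_class_companion (x := 0) (y := c) (w := e * c ^+ 2)) //.
- by congr (SL2_class (mx2 _ _ _ _)); rewrite E4; ring.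
- by apply/SL2_mx2; ring.
- by ring.
Qed.

(** Commuting with the two elementary unipotent matrices forces b = 0 and a = d, so tr(A)^2 = 4
    det(A). *)
Lemma SL2_central_trace (A : 'M[k]_2) : SL2 A -> SL2_central A -> \tr A ^+ 2 = 4.
Proof.
rewrite (mx2_eta A); move: (A 0 0) (A 0 1) (A 1 0) (A 1 1) => a b c d.
move=> /SL2_mx2 dA cA; rewrite mxtrace_mx2.
have /cA : SL2 (mx2 1 1 0 1 : 'M[k]_2) by apply/SL2_mx2; ring.
have /cA : SL2 (mx2 1 0 1 1 : 'M[k]_2) by apply/SL2_mx2; ring.
rewrite !mul_mx2 => /mx2_inj[Eb _ _ _] /mx2_inj[Ec Ed _ _].
have b0 : b = 0 by apply: (addrI (a * 1)); rewrite -[b]mulr1 -Eb; ring.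
have ad : d = a by apply: (addrI (1 * b)); rewrite -[d]mul1r Ed; ring.
rewrite b0 ad in dA *.
have -> : (a + a) ^+ 2 = 4 * (a * a - 0 * c) by ring.
by rewrite dA mulr1.
Qed.

End ProductClasses.

Theorem proposition3p16 (k : fieldType)
    (hu : u_le2 k) (hqc : ~ quadratically_closed k)
    (hchar : 2%N \notin [pchar k]) (hcard : more_than_elements k 5)
    (C : set 'M[k]_2) (hC : SL2_conjugacy_class C)
    (eps : k) (heps : eps != 0) :
  C `<=` set_square (Um1_class eps) <->
  [\/ semisimple_class C /\ unit_squares (2 - class_trace C),
      unipotent_class C,
      C = Um1_class (- eps)
    | C = [set 1%:M] /\ unit_squares (-1 : k)].
Proof.
have c2 : (2 : k) != 0 by move: hchar; rewrite inE.
have trE := class_traceE hC; move: hC trE => [A AS ->] trE.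
rewrite (trE _ (SL2_class_refl A)) {trE}.
apply: (iff_trans (class_subset_Um1_square _ _)); split=> [[a [c [ac0 E]]]|].
  have trA : \tr A = 2 - (eps * c) ^+ 2.
    rewrite -(mxtrace_Um1_prod eps a c); apply/esym/mxtrace_SL2_class.
    by rewrite E; exact: SL2_class_refl.
  (* For c = 0 the product is upper unipotent with corner - eps (1 + a^2): it is the identity when
     a^2 = -1 and gives a unipotent class otherwise. *)
  case: (eqVneq c 0) ac0 E trA => [-> _|c0 _] E trA.
    rewrite Um1_prod_upper in E.
    case: (eqVneq (1 + a ^+ 2) 0) E => [Ea|a1] E.
      have a0 : a != 0.
        by apply: contra_eq_neq Ea => ->; rewrite expr0n addr0 oner_eq0.
      apply: Or44; split; last first.
        by exists a => //; apply/eqP; rewrite eq_sym -addr_eq0 addrC Ea.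
      by rewrite E Ea mulr0 -scalar_mx2 SL2_class_scalar.
    by apply: Or42; exists (- eps * (1 + a ^+ 2)) => //; rewrite mulf_neq0 ?oppr_eq0.
  have ec0 : eps * c != 0 by rewrite mulf_neq0.
  (* For c != 0 the trace is not 2; this separates trace -2 from the semisimple case. *)
  case: (eqVneq ((eps * c) ^+ 2) 4) => [E4|N4].
    by apply: Or43; rewrite E Um1_prod_class_trm2.
  have t4 : \tr A ^+ 2 != 4.
    rewrite -subr_eq0 trA.
    have -> : (2 - (eps * c) ^+ 2) ^+ 2 - 4 = (eps * c) ^+ 2 * ((eps * c) ^+ 2 - 4) by ring.
    by rewrite mulf_neq0 ?expf_neq0 // subr_eq0.
  apply: Or41; split; last by exists (eps * c) => //; rewrite trA; ring.
  exists A; split=> //; last exact: semisimple_trace.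
  by move=> /(SL2_central_trace AS) tA4; rewrite tA4 eqxx in t4.
have class1 B : SL2_class A = SL2_class B -> SL2_class B A.
  by move=> <-; exact: SL2_class_refl.
case=> [[[B [BS E ncB ssB]] [z z0 tz]]|[e e0 E]|E|[E [a a0 Ea]]].
- have tAB : \tr A = \tr B by apply/mxtrace_SL2_class/class1.
  have t2 : \tr A = 2 - z ^+ 2 by rewrite -tz; ring.
  (* This c gives the product trace 2 - z^2, and the trace determines the class once it is not 2 or
     -2: z != 0 excludes 2, and non-central semisimplicity excludes -2. *)
  exists 0, (z / eps); split; first by right; rewrite mulf_neq0 ?invr_eq0.
  apply: (SL2_class_trace hu AS (SL2_Um1_prod _ _ _)).
    by rewrite mxtrace_Um1_prod mulrCA divff // mulr1.
  apply/negP; rewrite -subr_eq0.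
  have -> : \tr A ^+ 2 - 4 = (\tr A + 2) * - (2 - \tr A) by ring.
  rewrite mulf_eq0 oppr_eq0 tz sqrf_eq0 (negPf z0) orbF => /eqP tm2.
  apply: ncB; rewrite (semisimple_double_eigenvalue (s := -1) _ BS _ ssB).
  + by move=> g _; rewrite scalar_mxC.
  + by ring.
  + by rewrite -tAB; apply/eqP; rewrite -subr_eq0 -tm2; apply/eqP; ring.
(* The corner - eps (1 + a^2) must equal e b^2, that is, 1 + a^2 = (- e / eps) b^2. *)
- have w0 : - e / eps != 0 by rewrite mulf_neq0 ?invr_eq0 ?oppr_eq0.
  have [a [b [a0 b0 Eab]]] := one_add_square_mod_squares hu c2 hcard w0.
  exists a, 0; split; first by left.
  rewrite Um1_prod_upper -Eab E -(U_class_squares e b0) /U_class.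
  by congr (SL2_class (mx2 _ _ _ _)); field.
(* Chosen so that (eps c)^2 = 4, which gives trace -2. *)
- exists 0, (2 / eps).
  have c0 : 2 / eps != 0 by rewrite mulf_neq0 ?invr_eq0.
  split; first by right.
  by rewrite E Um1_prod_class_trm2 //; field.
- exists a, 0; split; first by left.
  by rewrite Um1_prod_upper -Ea subrr mulr0 -scalar_mx2 SL2_class_scalar.
Qed.
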